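(* Let $G$ be a finite simple connected graph and let $S_1, S_2 \subseteq E(G)$ be two disjoint edge cuts of $G$. Then in every rainbow coloring of $G$, the edges of $S_1 \cup S_2$ receive at least two different colors.
   Context: An edge cut of $G$ is a set of edges of the form $[X,\overline{X}]$, consisting of all edges with one endpoint in $X$ and the other in $\overline{X} = V(G)\setminus X$, where $X$ is a nonempty proper subset of $V(G)$. An edge coloring is a map $c : E(G)\to\{1,2,\dots,n\}$ for some $n\in\mathbb{N}$, where adjacent edges may have the same color. A path in $G$ is a rainbow path if its edges have pairwise different colors. The coloring $c$ is a rainbow coloring (and $G$ is rainbow connected under $c$) if every two vertices of $G$ are joined by a rainbow path. *)

(* Defs.v *)
From mathcomp Require Import all_boot.

Set Implicit Arguments.
Unset Strict Implicit.
Unset Printing Implicit Defensive.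

Record sgraph := SGraph {
  vertex :> finType;
  adj : rel vertex;
  adj_sym : symmetric adj;
  adj_irr : irreflexive adj
}.

(* The edge joining u and v is the two-element set [set u; v]. *)
Definition edges (G : sgraph) : {set {set G}} :=
  [set [set p.1; p.2] | p : G * G & adj p.1 p.2].

Definition connected (G : sgraph) : Prop :=
  forall x y : G, connect (@adj G) x y.

Definition cut (G : sgraph) (X : {set G}) : {set {set G}} :=
  [set f in edges G | [exists x in X, exists y in ~: X, f == [set x; y]]].

Definition edge_cut (G : sgraph) (S : {set {set G}}) : Prop :=
  exists X : {set G}, [/\ X != set0, X != setT & S = cut X].

(* A map E(G) -> {1, ..., n}, extended by arbitrary values to the vertex sets
   that are not edges. *)
Definition edge_coloring (G : sgraph) (n : nat) (c : {set G} -> nat) : Prop :=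
  forall f : {set G}, f \in edges G -> 1 <= c f <= n.

(* The edges traversed by the walk x :: p, in order. *)
Definition walk_edges (G : sgraph) (x : G) (p : seq G) : seq {set G} :=
  pairmap (fun u v : G => [set u; v]) x p.

Definition is_path (G : sgraph) (x y : G) (p : seq G) : Prop :=
  [/\ path (@adj G) x p, last x p = y & uniq (x :: p)].

Definition rainbow_path (G : sgraph) (c : {set G} -> nat) (x y : G)
    (p : seq G) : Prop :=
  is_path x y p /\ uniq [seq c f | f <- walk_edges x p].

Definition rainbow_coloring (G : sgraph) (n : nat) (c : {set G} -> nat) : Prop :=
  edge_coloring n c /\
  forall x y : G, exists p : seq G, rainbow_path c x y p.

(* Main.v *)
Require Import Defs.
From mathcomp Require Import all_boot.

(** Some pair of vertices is separated by both cuts. A rainbow path joining it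
    crosses each of the two cuts; the two crossing edges are distinct because
    the cuts are disjoint, so the rainbow property gives them different
    colors. *)

(** Applied to the edges of a rainbow path, it turns equality of colors into equality of edges. *)
Lemma uniq_map_in_inj (T1 T2 : eqType) (f : T1 -> T2) (s : seq T1) :
  uniq (map f s) -> {in s &, injective f}.
Proof.
elim: s => [|a s IHs] //= /andP[fa_notin uniq_fs] x y.
rewrite !inE => /predU1P[->|xs] /predU1P[->|ys] // eq_f.
- by rewrite eq_f map_f in fa_notin.
- by rewrite -eq_f map_f in fa_notin.
- exact: IHs.
Qed.

Lemma in_cut (G : sgraph) (X : {set G}) (u v : G) :
  adj u v -> (u \in X) != (v \in X) -> [set u; v] \in cut X.
Proof.
move=> uv sep; rewrite inE; apply/andP; split.
  by apply/imsetP; exists (u, v); rewrite ?inE.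
case uX: (u \in X) sep; case vX: (v \in X) => // _; apply/exists_inP.
- by exists u => //; apply/exists_inP; exists v; rewrite // inE vX.
(* Here [v] is the endpoint in [X], so the edge is read in the reverse order. *)
- exists v => //; apply/exists_inP; exists u; first by rewrite inE uX.
  by rewrite setUC.
Qed.

(** Membership in [X] must change at some step of the walk; the induction picks the first such
    step. *)
Lemma walk_crosses_cut (G : sgraph) (X : {set G}) (x : G) (p : seq G) :
  path (@adj G) x p -> (x \in X) != (last x p \in X) ->
  exists2 f, f \in walk_edges x p & f \in cut X.
Proof.
elim: p x => [|y p IHp] x /=; first by rewrite eqxx.
case/andP=> xy yp sep; case: (eqVneq (x \in X) (y \in X)) => [eq_xy|neq_xy].
  rewrite eq_xy in sep; have [f fp fX] := IHp y yp sep.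
  by exists f; rewrite // inE fp orbT.
by exists [set x; y]; [rewrite inE eqxx | exact: in_cut].
Qed.

Lemma proper_set_separates (T : finType) (X : {set T}) (a : T) :
  X != set0 -> X != setT -> exists b, (a \in X) != (b \in X).
Proof.
(* Take [b] inside [X] and [d] outside: one of them is on the side opposite to [a]. *)
move=> /set0Pn[b bX]; rewrite -subTset => /subsetPn[d _ dX].
case aX: (a \in X); first by exists d; rewrite (negPf dX).
by exists b; rewrite bX.
Qed.

(** Let [X] separate [a] from [b], and [Y] separate [a] from [d]. If neither pair is separated by
    both sets, then [b] is on the side of [a] for [Y] and [d] is on the side of [a] for [X], so the
    pair [b], [d] is separated by both. *)
Lemma proper_sets_separate_pair (T : finType) (X Y : {set T}) :
  X != set0 -> X != setT -> Y != set0 -> Y != setT ->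
  exists x y, (x \in X) != (y \in X) /\ (x \in Y) != (y \in Y).
Proof.
move=> X0 XT Y0 YT; have /set0Pn[a _] := X0.
have [b abX] := proper_set_separates T X a X0 XT.
have [d adY] := proper_set_separates T Y a Y0 YT.
have [abY|abY] := eqVneq (a \in Y) (b \in Y); last by exists a, b.
have [adX|adX] := eqVneq (a \in X) (d \in X); last by exists a, d.
by exists b, d; rewrite -abY -adX eq_sym.
Qed.

Theorem theorem1p4 (G : sgraph) (S1 S2 : {set {set G}}) (n : nat)
  (c : {set G} -> nat) :
  connected G ->
  edge_cut S1 -> edge_cut S2 -> [disjoint S1 & S2] ->
  rainbow_coloring n c ->
  exists f g : {set G},
    [/\ f \in S1 :|: S2, g \in S1 :|: S2 & c f != c g].
Proof.
move=> _ [X [X0 XT ->]] [Y [Y0 YT ->]] disjXY [_ rainbow].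
have [x [y [sepX sepY]]] := proper_sets_separate_pair G X Y X0 XT Y0 YT.
have [p [[xp last_p _] uniq_c]] := rainbow x y.
rewrite -last_p in sepX sepY.
have [f fp fX] := walk_crosses_cut G X x p xp sepX.
have [g gp gY] := walk_crosses_cut G Y x p xp sepY.
exists f, g; split; rewrite ?in_setU ?fX ?gY ?orbT //.
apply/eqP => /(uniq_map_in_inj _ _ _ _ uniq_c f g fp gp) eq_fg.
by rewrite -eq_fg (disjointFr disjXY fX) in gY.
Qed.
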